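(* Let $H$ be a complex Hilbert space and let $T=A+iB\in B(H)$ be normal, where $A=\frac{T+T^*}{2}$ and $B=\frac{T-T^*}{2i}$ are self-adjoint. Then \[T\text{ is invertible}\Longleftrightarrow |A|+|B| \text{ is invertible.}\] In particular, if $\lambda=\alpha+i\beta$ with $\alpha,\beta\in\mathbb{R}$, then \[\lambda\in\sigma(T)\Longleftrightarrow |A-\alpha I|+|B-\beta I| \text{ is not invertible.}\]
   Context: $B(H)$ denotes the algebra of all bounded linear operators on $H$; invertible means invertible in $B(H)$. $|S|=\sqrt{S^*S}$ is the unique positive square root of $S^*S$, $I$ is the identity operator and $\sigma(T)$ is the spectrum of $T$. *)

(* Defs.v *)
From HB Require Import structures.
From mathcomp Require Import all_boot all_order all_algebra.
From mathcomp Require Import complex.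
From mathcomp Require Import all_classical all_reals all_analysis.

Set Implicit Arguments.
Unset Strict Implicit.
Unset Printing Implicit Defensive.

Import Order.TTheory GRing.Theory Num.Theory Num.Def.
Import numFieldNormedType.Exports.

Local Open Scope classical_set_scope.
Local Open Scope ring_scope.

(* The inner product is linear in its first argument and conjugate-linear in
   the second one. *)
HB.mixin Record CompleteNormedModule_isHilbert (R : realType) H
    of CompleteNormedModule R[i] H := {
  inner : {dot H for conjC} ;
  inner_normE : forall x : H, inner x x = `|x| ^+ 2
}.

#[short(type="hilbertType")]
HB.structure Definition Hilbert (R : realType) :=
  { H of CompleteNormedModule R[i] H & CompleteNormedModule_isHilbert R H }.

Notation "'[ x , y ]" := (inner x y) : ring_scope.

Section BoundedOperators.
Variables (R : realType) (H : hilbertType R).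

Definition bounded_linear : {pred H -> H} := fun f =>
  `[< linear f /\ exists M : R[i], forall x, `|f x| <= M * `|x| >].

Record bop := BOp { bop_fun :> H -> H ; bop_subproof : bounded_linear bop_fun }.

HB.instance Definition _ := [isSub for bop_fun].
HB.instance Definition _ := [Choice of bop by <:].

Fact bounded_linear_submod_closed : submod_closed bounded_linear.
Proof.
split=> [|a f g /asboolP[lf [M fM]] /asboolP[lg [N gN]]]; apply/asboolP.
  split=> [b x y|]; first by rewrite scaler0 addr0.
  by exists 0 => x; rewrite mul0r normr0.
split=> [b x y /=|].
  rewrite !fctE lf lg !scalerDr !scalerA addrACA.
  by rewrite (mulrC b a).
exists (`|a| * M + N) => x; rewrite mulrDl -mulrA.
apply: (le_trans (ler_normD _ _)); apply: lerD => //.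
by rewrite normrZ ler_wpM2l.
Qed.
HB.instance Definition _ :=
  GRing.isSubmodClosed.Build _ _ bounded_linear bounded_linear_submod_closed.
HB.instance Definition _ := [SubChoice_isSubLmodule of bop by <:].

Fact bop_linear (T : bop) : linear T.
Proof. by have /asboolP[] := bop_subproof T. Qed.
HB.instance Definition _ (T : bop) :=
  GRing.isLinear.Build R[i] H H *:%R T (bop_linear T).

Fact bop_bounded (T : bop) : exists M : R[i], forall x, `|T x| <= M * `|x|.
Proof. by have /asboolP[] := bop_subproof T. Qed.

Fact bop_one_subproof : bounded_linear idfun.
Proof. by apply/asboolP; split=> //; exists 1 => x; rewrite mul1r. Qed.
Definition bop_one := BOp bop_one_subproof.

Fact bop_mul_subproof (S T : bop) : bounded_linear (S \o T).
Proof.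
apply/asboolP; split=> [a x y /=|]; first by rewrite !linearP.
have [M SM] := bop_bounded S; have [N TN] := bop_bounded T.
have M0 x : `|S x| <= `|M| * `|x|.
  have [->|x0] := eqVneq x 0; first by rewrite linear0 !normr0 mulr0.
  apply: (le_trans (SM x)); rewrite ler_wpM2r// real_ler_norm//.
  suff: 0 <= M * `|x| by rewrite pmulr_lge0 ?normr_gt0// => /ger0_real.
  exact: le_trans (SM x).
exists (`|M| * N) => x; apply: (le_trans (M0 _)).
by rewrite -mulrA ler_wpM2l.
Qed.
Definition bop_mul (S T : bop) := BOp (bop_mul_subproof S T).

Fact bop_mulA : associative bop_mul.
Proof. by move=> S T U; apply: val_inj. Qed.
Fact bop_mul1 : left_id bop_one bop_mul.
Proof. by move=> S; apply: val_inj. Qed.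
Fact bop_1mul : right_id bop_one bop_mul.
Proof. by move=> S; apply: val_inj. Qed.
Fact bop_mulDl : left_distributive bop_mul +%R.
Proof. by move=> S T U; apply: val_inj. Qed.
Fact bop_mulDr : right_distributive bop_mul +%R.
Proof.
move=> S T U; apply: val_inj; apply/funext => x /=.
exact: linearD.
Qed.
(* Not a [nzRingType]: H may be the zero space, where 1 = 0. *)
HB.instance Definition _ := GRing.Zmodule_isPzRing.Build bop
  bop_mulA bop_mul1 bop_1mul bop_mulDl bop_mulDr.

Implicit Types S T P : bop.

Definition invertible T := exists S, S * T = 1 /\ T * S = 1.

Definition spectrum T : set R[i] := [set l | ~ invertible (T - l *: (1 : bop))].

(* By the Riesz representation theorem the set below is a singleton, so the
   default value 0 is never used. *)
Definition adjoint T : bop :=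
  xget 0 [set S : bop | forall x y : H, '[T x, y] = '[x, S y]].

Definition normal_op T := T * adjoint T = adjoint T * T.

(* [0 <= z] in [R[i]] means that z is a nonnegative real; as H is complex, this
   forces T to be self-adjoint. *)
Definition positive_op T := forall x : H, 0 <= '[T x, x].

(* The set below is a singleton whenever S is positive (existence and uniqueness
   of the positive square root). *)
Definition sqrt_op S : bop := xget 0 [set P : bop | positive_op P /\ P * P = S].

Definition abs_op S : bop := sqrt_op (adjoint S * S).

Definition re_op T : bop := (2^-1 : R[i]) *: (T + adjoint T).
Definition im_op T : bop := ((2 * 'i)^-1 : R[i]) *: (T - adjoint T).

End BoundedOperators.

(* Main.v *)
(* Write P = |A| and Q = |B|.  For normal T the parallelogram law gives
   |T x|^2 = |A x|^2 + |B x|^2 = |P x|^2 + |Q x|^2, so if P + Q is bounded below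
   then so is T.  Conversely a positive operator bounded by M satisfies
   |P x|^2 <= M <P x, x>, so if T is bounded below then P + Q is coercive.  For
   normal and for self-adjoint positive operators, being invertible reduces to
   these lower bounds; surjectivity, like the existence of adjoints, comes from
   minimising a coercive quadratic functional.  For a contraction K, the square root
   of 1 - K is 1 - lim Y_n with Y_{n+1} = (K + Y_n^2) / 2, whose increments are
   dominated in norm by those of the scalar iteration with K = 1.  The second
   statement is the first one applied to T - lambda. *)
Require Import Defs.
From mathcomp Require Import all_boot all_order all_algebra.
From mathcomp Require Import complex.
From mathcomp Require Import all_classical all_reals all_analysis.
From mathcomp Require Import ring lra.
Import Num.Def.
Local Open Scope ring_scope.
Import Order.TTheory GRing.Theory Num.Theory numFieldNormedType.Exports.

Set Implicit Arguments.
Unset Strict Implicit.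
Unset Printing Implicit Defensive.

(** * The real inner product underlying the complex one *)

Section RealStructure.
Context {R : realType} {H : hilbertType R}.
Implicit Types (x y z : H) (t : R) (T : bop H).

(* Re '[x, y] is a real inner product recovering the complex one (innerE); it
   lets the estimates be done in the totally ordered field R. *)
Definition rdot x y : R := complex.Re '[x, y].
Definition nrm x : R := complex.Re `|x|.

Lemma nrmE x : `|x| = ((nrm x)%:C)%C.
Proof.
have := normr_ge0 x; rewrite /nrm; case: `|x| => a b.
by rewrite lecE /= => /andP[/eqP-> _].
Qed.

Lemma nrm_ge0 x : 0 <= nrm x.
Proof. by rewrite -lecR -nrmE normr_ge0. Qed.

Lemma nrm0 : nrm (0 : H) = 0.
Proof. by rewrite /nrm normr0. Qed.

Lemma nrm0_eq0 x : nrm x = 0 -> x = 0.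
Proof. by move=> x0; apply/normr0_eq0; rewrite nrmE x0. Qed.

Lemma nrmD x y : nrm (x + y) <= nrm x + nrm y.
Proof. by rewrite -lecR rmorphD /= -!nrmE ler_normD. Qed.

Lemma nrmN x : nrm (- x) = nrm x.
Proof. by rewrite /nrm normrN. Qed.

Lemma nrm_distC x y : nrm (x - y) = nrm (y - x).
Proof. by rewrite /nrm distrC. Qed.

Lemma nrmZ (a : R[i]) x : nrm (a *: x) = complex.Re `|a| * nrm x.
Proof. by rewrite /nrm normrZ !nrmE normc_def /= !(mulr0, mul0r, subr0). Qed.

Lemma nrmZr t x : nrm ((t%:C)%C *: x) = `|t| * nrm x.
Proof. by rewrite nrmZ normc_def /= expr0n addr0 sqrtr_sqr. Qed.

Lemma conjCE (a : R[i]) : conjC a = (conjc a)%C.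
Proof.
have [->|a0] := eqVneq a 0; first by rewrite conjC0 conjc0.
by apply: (mulfI a0); rewrite -normCK sqr_normc.
Qed.

Lemma rdotC x y : rdot x y = rdot y x.
Proof. by rewrite /rdot hermC expr0 mul1r /= conjCE; case: '[y, x]. Qed.

Lemma rdotDl x y z : rdot (x + y) z = rdot x z + rdot y z.
Proof. by rewrite /rdot linearDl /=; case: '[x, z] => ? ?; case: '[y, z]. Qed.

Lemma rdotDr x y z : rdot z (x + y) = rdot z x + rdot z y.
Proof. by rewrite rdotC rdotDl !(rdotC z). Qed.

Lemma rdotZl t x y : rdot ((t%:C)%C *: x) y = t * rdot x y.
Proof.
by rewrite /rdot linearZl_LR /=; case: '[x, y] => ? ? /=; rewrite mul0r subr0.
Qed.

Lemma rdotZr t x y : rdot x ((t%:C)%C *: y) = t * rdot x y.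
Proof. by rewrite rdotC rdotZl rdotC. Qed.

Lemma rdot0l x : rdot 0 x = 0.
Proof. by rewrite /rdot linear0l. Qed.

Lemma rdotNl x y : rdot (- x) y = - rdot x y.
Proof. by rewrite /rdot linearNl /=; case: '[x, y]. Qed.

Lemma rdotNr x y : rdot x (- y) = - rdot x y.
Proof. by rewrite rdotC rdotNl rdotC. Qed.

Lemma rdotxx x : rdot x x = nrm x ^+ 2.
Proof. by rewrite /rdot inner_normE nrmE -rmorphXn. Qed.

Lemma rdot_il x y : rdot ('i%C *: x) y = - complex.Im '[x, y].
Proof.
by rewrite /rdot linearZl_LR /=; case: '[x, y] => a b /=; rewrite mul0r mul1r sub0r.
Qed.

Lemma innerE x y : '[x, y] = (rdot x y +i* - rdot ('i%C *: x) y)%C.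
Proof. by rewrite rdot_il opprK /rdot; case: '[x, y]. Qed.

Lemma rdot_ext x y : (forall z, rdot x z = rdot y z) -> x = y.
Proof.
move=> xy; apply/subr0_eq/nrm0_eq0/eqP.
by rewrite -sqrf_eq0 -rdotxx rdotDl rdotNl xy subrr.
Qed.

Definition rdotE := (rdotDl, rdotDr, rdotNl, rdotNr, rdotZl, rdotZr).

Lemma rdot_cauchy x y : `|rdot x y| <= nrm x * nrm y.
Proof.
suff h z : rdot z y <= nrm z * nrm y.
  rewrite ler_norml h andbT; have := h (- x); rewrite rdotNl nrmN; lra.
(* The squared norm of this vector is [2 * nrm z * nrm y * (nrm z * nrm y - rdot z y)]; dividing by
   the first factors requires both norms to be nonzero, hence the case split. *)
have := nrm_ge0 ((nrm y)%:C%C *: z - (nrm z)%:C%C *: y).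
rewrite -(@ler_pXn2r _ 2) ?nnegrE ?nrm_ge0 // expr0n /= -rdotxx !rdotE !rdotxx.
rewrite (rdotC y z).
have := nrm_ge0 y; have := nrm_ge0 z.
rewrite le0r => /orP[/eqP z0 _|z0].
  by move=> _; rewrite (nrm0_eq0 z0) rdot0l nrm0 mul0r.
rewrite le0r => /orP[/eqP y0|y0].
  by move=> _; rewrite (nrm0_eq0 y0) rdotC rdot0l nrm0 mulr0.
move=> h; rewrite -(ler_pM2l (mulr_gt0 z0 y0)); nra.
Qed.

Lemma Re_normcE (a : R[i]) : ((complex.Re `|a|)%:C)%C = `|a|.
Proof. by rewrite normc_def. Qed.

Lemma Re_normc_ge0 (a : R[i]) : 0 <= complex.Re `|a|.
Proof. by rewrite -lecR Re_normcE normr_ge0. Qed.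

(** * Real operator bounds and completeness in terms of [nrm] *)

Lemma bop_nrm_bounded T : exists2 M : R, 0 < M & forall x, nrm (T x) <= M * nrm x.
Proof.
have [M TM] := bop_bounded T; exists (complex.Re `|M| + 1) => [|x].
  by rewrite ltr_wpDl ?Re_normc_ge0.
have [->|x0] := eqVneq x 0; first by rewrite linear0 nrm0 mulr0.
have nM : nrm (T x) <= complex.Re `|M| * nrm x.
  rewrite -lecR rmorphM /= -!nrmE Re_normcE.
  apply: le_trans (TM x) _; rewrite ler_wpM2r // real_ler_norm //.
  suff: 0 <= M * `|x| by rewrite pmulr_lge0 ?normr_gt0 // => /ger0_real.
  exact: le_trans (TM x).
by rewrite mulrDl mul1r ler_wpDr // nrm_ge0.
Qed.

Lemma bop_of (f : H -> H) (M : R) :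
  linear f -> (forall x, nrm (f x) <= M * nrm x) -> exists T : bop H, forall x, T x = f x.
Proof.
move=> lf fM; have fb : bounded_linear f.
  apply/asboolP; split=> //; exists (M%:C)%C => x.
  by rewrite !nrmE -rmorphM /= lecR.
by exists (BOp fb).
Qed.

Lemma nrm_complete (u : nat -> H) :
  (forall e : R, 0 < e ->
     exists N, forall n m, (N <= n)%N -> (N <= m)%N -> nrm (u n - u m) < e) ->
  exists l, forall e : R, 0 < e -> exists N, forall n, (N <= n)%N -> nrm (u n - l) < e.
Proof.
move=> uC; have /cauchy_cvgP ul : cauchy (u @ \oo)%classic.
  apply/cauchy_ballP => e e0.
  (* Radii of balls live in [R[i]], where a positive element is real, so the real Cauchy condition
     covers all of them. *)
  have er : 0 < complex.Re e by move: e0; rewrite ltcE => /andP[].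
  have eE : e = (complex.Re e)%:C%C.
    by move: e0; case: (e) => a b; rewrite ltcE /= => /andP[/eqP->].
  have [N uN] := uC _ er.
  pose U := [set x | exists2 n, (N <= n)%N & u n = x]%classic.
  exists (U, U) => /=.
    by split; exists N => // n /= Nn; exists n.
  move=> [x y] /= [[n Nn <-] [m Nm <-]]; rewrite -ball_normE /= nrmE eE ltcR.
  exact: uN.
exists (lim (u @ \oo)%classic) => e e0.
have e0' : 0 < (e%:C)%C by rewrite ltcR.
move/cvgrPdist_lt : ul => /(_ _ e0') [N _ uN]; exists N => n Nn.
by have := uN _ Nn; rewrite /= distrC nrmE ltcR.
Qed.

(** * Minimising a coercive quadratic functional *)

(** The vector [u] is the minimiser of [J], whose first variation at [u] in direction [y] is
    [2 * (rdot (S u) y - f y)]. With [S = 1] this is the Riesz representation theorem; in general it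
    solves [S u = y]. *)
Lemma coercive_represents (S : bop H) (f : H -> R) (c F : R) :
  0 < c -> (forall x y, rdot (S x) y = rdot x (S y)) ->
  (forall x, c * nrm x ^+ 2 <= rdot (S x) x) ->
  (forall x y, f (x + y) = f x + f y) ->
  (forall t x, f ((t%:C)%C *: x) = t * f x) ->
  (forall x, f x <= F * nrm x) ->
  exists u, forall y, rdot (S u) y = f y.
Proof.
move=> c0 Ssym Sc fD fZ fF.
pose J x := rdot (S x) x - 2 * f x.
have JD x h t : J (x + (t%:C)%C *: h) =
    J x + 2 * t * (rdot (S x) h - f h) + t ^+ 2 * rdot (S h) h.
  by rewrite /J linearD linearZ /= !rdotE fD fZ (rdotC (S h)) -Ssym; ring.
have Jlb x : - (F ^+ 2 / c) <= J x.
  have := Sc x; have := fF x; rewrite /J => h1 h2.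
  (* Completing the square in [c * nrm x ^+ 2 - 2 * F * nrm x], which bounds [J x] from below. *)
  have : 0 <= c * (nrm x - F / c) ^+ 2 by rewrite mulr_ge0 ?sqr_ge0 // ltW.
  have -> : c * (nrm x - F / c) ^+ 2 = c * nrm x ^+ 2 - 2 * (F * nrm x) + F ^+ 2 / c.
    by field; rewrite gt_eqF.
  lra.
pose E : set R := range J.
have Einf : has_inf E.
  split; first by exists (J 0), 0.
  by exists (- (F ^+ 2 / c)) => _ [x _ <-].
pose d := inf E.
have dJ x : d <= J x by apply: ge_inf; [exact: Einf.2 | exists x].
(* Midpoint argument: the value of [J] at the midpoint is [(J x + J y) / 2 - rdot (S w) w / 4] with
   [w = y - x], and it is at least [d]. Hence minimising sequences are Cauchy. *)
have dist x y e : J x < d + e -> J y < d + e -> c * nrm (x - y) ^+ 2 < 4 * e.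
  move=> Jx Jy; rewrite nrm_distC; set w := y - x.
  have := dJ (x + ((2^-1 : R)%:C)%C *: w); have := Sc w.
  have := JD x w 1; rewrite scale1r /w addrC subrK -/w JD; lra.
have small (e : R) : 0 < e -> exists N, forall n, (N <= n)%N -> n.+1%:R^-1 < e.
  by move=> e0; have [N _ uN] := near_infty_natSinv_lt (PosNum e0); exists N => n /uN.
have /choice[u uJ] : forall n, exists x, J x < d + n.+1%:R^-1.
  move=> n; have [|_ [x _ <-] Jx] := @inf_adherent _ E n.+1%:R^-1 _ Einf.
    by rewrite invr_gt0.
  by exists x.
have [e e0|l ul] := nrm_complete (u := u).
  have [|N uN] := small (c * e ^+ 2 / 4).
    by rewrite divr_gt0 // mulr_gt0 // exprn_gt0.
  exists N => n m Nn Nm.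
  rewrite -(@ltr_pXn2r _ 2) ?nnegrE ?nrm_ge0 ?ltW // -(ltr_pM2l c0).
  have := @dist (u n) (u m) (c * e ^+ 2 / 4).
  rewrite (mulrC 4) divfK // ; apply.
    by apply: lt_trans (uJ n) _; rewrite ltrD2l uN.
  by apply: lt_trans (uJ m) _; rewrite ltrD2l uN.
have Jl : J l <= d.
  apply/ler_addgt0Pr => e e0.
  (* Expanding [J] at [l] and dropping the nonnegative quadratic term gives
     [J l <= J (u n) + G * nrm (u n - l)]; the summand 1 keeps [G] positive. *)
  pose G := 2 * (nrm (S l) + `|F|) + 1.
  have G0 : 0 < G by rewrite /G; have := nrm_ge0 (S l); have := normr_ge0 F; lra.
  have [|N1 uN1] := small (e / 2); first by rewrite divr_gt0.
  have [|N2 uN2] := ul (e / 2 / G); first by rewrite !divr_gt0.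
  pose n := maxn N1 N2; have := uJ n; have := uN1 n (leq_maxl _ _).
  have := uN2 n (leq_maxr _ _); rewrite ltr_pdivlMr // => h1 h2 h3.
  have := JD l (u n - l) 1; rewrite scale1r addrC subrK; set h := u n - l in h1 *.
  move=> h9; set w := _^-1 in h2 h3.
  have := rdot_cauchy (S l) h; rewrite ler_norml => /andP[h4 _].
  have h5 := fF h.
  have h6 : F * nrm h <= `|F| * nrm h by rewrite ler_wpM2r ?nrm_ge0 // ler_norm.
  have h7 : 0 <= rdot (S h) h by apply: le_trans (Sc h); rewrite mulr_ge0 ?sqr_ge0 // ltW.
  have h8 := nrm_ge0 h.
  rewrite /G in h1; move: h1 h2 h3 h9 h4 h5 h6 h7 h8; lra.
exists l => y; apply/eqP; rewrite -subr_eq0; set D := _ - _.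
set q := rdot (S y) y.
have q0 : 0 <= q by apply: le_trans (Sc y); rewrite mulr_ge0 ?sqr_ge0 // ltW.
(* The optimal step along [y] would be [- D / q]; the denominator [q + 1] stays positive when
   [q = 0] and still lowers [J] strictly unless [D = 0]. *)
have := le_trans Jl (dJ (l + ((- D / (q + 1))%:C)%C *: y)).
rewrite JD -/D -/q -addrA lerDl.
have -> : 2 * (- D / (q + 1)) * D + (- D / (q + 1)) ^+ 2 * q =
    - (D ^+ 2 * (q + 2) / (q + 1) ^+ 2).
  by field; rewrite gt_eqF //; lra.
rewrite oppr_ge0 pmulr_lle0; last by rewrite invr_gt0 exprn_gt0 //; lra.
rewrite pmulr_lle0; last by lra.
by move=> DD; rewrite -sqrf_eq0 eq_le DD sqr_ge0.
Qed.

(** * Adjoints and positive operators *)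

Lemma rdotZC (a : R[i]) x y : rdot (a *: x) y = rdot x ((conjc a)%C *: y).
Proof.
rewrite /rdot linearZl_LR /= (hermC _ x y) (hermC _ x (_ *: y)) expr0 !mul1r /=.
by rewrite linearZl_LR /= rmorphM /= !conjCE conjcK.
Qed.

Lemma rdot_iNi x y : rdot ('i%C *: x) y = - rdot x ('i%C *: y).
Proof.
rewrite rdotZC (_ : (conjc 'i)%C = - 'i%C :> R[i]) ?scaleNr ?rdotNr //.
by rewrite /=; apply/eqP; rewrite eq_complex /= oppr0 !eqxx.
Qed.

Lemma rdot_ii x y : rdot ('i%C *: x) ('i%C *: y) = rdot x y.
Proof. by rewrite rdot_iNi scalerA -expr2 sqr_i scaleN1r rdotNr opprK. Qed.

Lemma adjoint_exists T : exists S : bop H, forall x y, '[T x, y] = '[x, S y].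
Proof.
have [M M0 TM] := bop_nrm_bounded T.
(* Riesz representation of the real functional [y |-> rdot z (T y)]; the representing vector [f z]
   is the value of the adjoint at [z]. *)
have /choice[f fT] z : exists u, forall y, rdot u y = rdot z (T y).
  apply: (@coercive_represents 1 (fun y => rdot z (T y)) 1 (nrm z * M)) => //.
  - by move=> x; rewrite mul1r rdotxx.
  - by move=> x y; rewrite linearD rdotDr.
  - by move=> t x; rewrite linearZ /= rdotZr.
  - move=> x; apply: le_trans (ler_norm _) _; apply: le_trans (rdot_cauchy _ _) _.
    by rewrite -mulrA ler_wpM2l ?nrm_ge0.
have lf : linear f.
  move=> a x y; apply: rdot_ext => z.
  by rewrite fT !rdotDl !rdotZC fT fT linearZ.
have [S SE] : exists S : bop H, forall x, S x = f x.
  apply: (@bop_of _ M) => // x.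
  have [->|] := eqVneq (nrm (f x)) 0; first by rewrite mulr_ge0 ?nrm_ge0 // ltW.
  move=> fx; have fx0 : 0 < nrm (f x) by rewrite lt_neqAle eq_sym fx nrm_ge0.
  rewrite -(ler_pM2r fx0) -expr2 -rdotxx fT (mulrC M) -mulrA.
  apply: le_trans (ler_norm _) _; apply: le_trans (rdot_cauchy _ _) _.
  by rewrite ler_wpM2l ?nrm_ge0.
exists S => x y; rewrite !innerE SE.
have h z : rdot (T z) y = rdot z (f y) by rewrite (rdotC z) fT rdotC.
by rewrite -linearZ /= !h.
Qed.

Lemma adjointE T x y : '[T x, y] = '[x, adjoint T y].
Proof.
rewrite /adjoint; case: xgetP => [S _|noS]; first exact.
by have [S /noS] := adjoint_exists T.
Qed.

Lemma adjoint_unique T (S : bop H) : (forall x y, '[T x, y] = '[x, S y]) -> adjoint T = S.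
Proof.
move=> TS; apply: val_inj; apply/funext => y; apply: rdot_ext => x.
by rewrite !(rdotC _ x) /rdot -TS -adjointE.
Qed.

Lemma rdot_adjoint T x y : rdot (T x) y = rdot x (adjoint T y).
Proof. by rewrite /rdot adjointE. Qed.

Lemma positive_opP T : positive_op T <->
  (forall x y, rdot (T x) y = rdot x (T y)) /\ (forall x, 0 <= rdot (T x) x).
Proof.
split=> [Tpos|[Tsym Tpos] x].
  have Tre x : rdot ('i%C *: T x) x = 0.
    by have := Tpos x; rewrite innerE lecE /= oppr_eq0 => /andP[/eqP].
  split=> [x y|x]; last by have := Tpos x; rewrite innerE lecE /= => /andP[].
  (* Polarisation: since the imaginary part of the quadratic form vanishes everywhere, the cross
     terms here reduce to [rdot (T x) y - rdot (T y) x = 0]. *)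
  have := Tre (x + 'i%C *: y).
  rewrite linearD linearZ /= scalerDr !rdotDl !rdotDr !Tre rdot_ii.
  have := Tre ('i%C *: y); rewrite linearZ /= => ->.
  rewrite scalerA -expr2 sqr_i scaleN1r rdotNl (rdotC x); lra.
rewrite innerE lecE /= Tpos andbT oppr_eq0.
have : rdot ('i%C *: T x) x = - rdot ('i%C *: T x) x.
  by rewrite -[in LHS]linearZ /= Tsym rdot_iNi rdotC.
by move=> h; apply/eqP; lra.
Qed.

(** Positivity tested at [x - M^-1 T x], combined with the upper bound tested at [T x], leaves
    exactly this inequality. *)
Lemma positive_nrm_le T (M : R) : 0 < M ->
  (forall x y, rdot (T x) y = rdot x (T y)) -> (forall x, 0 <= rdot (T x) x) ->
  (forall x, rdot (T x) x <= M * nrm x ^+ 2) ->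
  forall x, nrm (T x) ^+ 2 <= M * rdot (T x) x.
Proof.
move=> M0 Tsym Tpos TM x.
have := Tpos (x - ((M^-1)%:C)%C *: T x); have := TM (T x).
rewrite linearB linearZ /= !rdotE (Tsym (T x) x) !rdotxx.
set n := nrm _; set e := rdot (T (T x)) _; set a := rdot _ _ => h1 h2.
have : 0 <= M * (a - M^-1 * n ^+ 2).
  apply: mulr_ge0; first exact: ltW.
  apply: le_trans h2 _; rewrite -subr_ge0.
  have -> : a - M^-1 * n ^+ 2 -
     (a + - (M^-1 * n ^+ 2) - (M^-1 * n ^+ 2 + - (M^-1 * (M^-1 * e)))) =
     M^-1 ^+ 2 * (M * n ^+ 2 - e) by field; rewrite gt_eqF.
  by rewrite mulr_ge0 ?sqr_ge0 // subr_ge0.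
by rewrite mulrBr mulrA mulfV ?gt_eqF // mul1r subr_ge0.
Qed.

(** * Limits with an explicit rate *)

Definition vanishing (r : nat -> R) :=
  forall e, 0 < e -> exists N, forall n, (N <= n)%N -> r n < e.

Lemma vanishing_le (r : nat -> R) (a C : R) :
  vanishing r -> (forall n, 0 <= r n) -> (forall n, a <= r n * C) -> a <= 0.
Proof.
move=> r0 rge0 ar; rewrite leNgt; apply/negP => a0.
have C0 : 0 < C.
  rewrite ltNge; apply/negP => C0; have := ar 0; rewrite leNgt => /negP[].
  by apply: le_lt_trans a0; rewrite mulr_ge0_le0.
have [|N rN] := r0 (a / C); first by rewrite divr_gt0.
have := rN N (leqnn _); rewrite ltr_pdivlMr // ltNge => /negP[]; exact: ar.
Qed.

(** Letting [k] tend to infinity preserves the bound. Keeping the rate lets identities for a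
    pointwise limit of operators be checked by estimating their defect at stage [n]. *)
Lemma nrm_complete_rate (u : nat -> H) (r : nat -> R) (C : R) :
  vanishing r -> 0 <= C -> (forall n, 0 <= r n) ->
  (forall n k, nrm (u (n + k)%N - u n) <= r n * C) ->
  exists l, forall n, nrm (u n - l) <= r n * C.
Proof.
move=> r0 C0 rge0 ur.
have Cauchy e : 0 < e -> exists N, forall n k, (N <= n)%N -> nrm (u (n + k)%N - u n) < e.
  move=> e0; have C1 : 0 < C + 1 by rewrite ltr_wpDl.
  have [|N rN] := r0 (e / (C + 1)); first by rewrite divr_gt0.
  exists N => n k Nn; apply: le_lt_trans (ur n k) _.
  have := rN n Nn; rewrite ltr_pdivlMr // => h.
  by apply: le_lt_trans h; rewrite ler_wpM2l // lerDl.
have [e e0|l ul] := nrm_complete (u := u).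
  have [N uN] := Cauchy e e0; exists N => n m Nn Nm.
  wlog nm : n m Nn Nm / (m <= n)%N => [hw|]; last by rewrite -(subnKC nm) uN.
  by have [/hw|/ltnW/hw] := leqP m n; [|rewrite nrm_distC]; apply.
exists l => n; apply/ler_addgt0Pr => e /ul[N uN].
have := nrmD (u n - u (n + N)%N) (u (n + N)%N - l).
rewrite addrA subrK nrm_distC => h; apply: le_trans h _.
by apply: lerD; [exact: ur | rewrite ltW // uN // leq_addl].
Qed.

(** * The square root iteration *)

Definition sqrt_scalar (n : nat) : R := iter n (fun s => (1 + s ^+ 2) / 2) 0.

(** The gap [e = 1 - s] evolves by [e |-> e * (1 - e / 2)], which decays like [2 / n]. *)
Lemma sqrt_scalar_bounds n :
  0 <= 1 - sqrt_scalar n <= 2 / n.+2%:R /\ 0 <= sqrt_scalar n.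
Proof.
rewrite /sqrt_scalar; elim: n => [|n] /=; first by rewrite subr0 divff // ler01 !lexx.
set s := iter _ _ _ => -[/andP[s1 sn] s0].
have n0 : 0 <= n%:R :> R by [].
move: sn; rewrite -[n.+3]addn3 -[n.+2]addn2 !natrD.
move: (n%:R) n0 => v v0; rewrite !ler_pdivlMr; try lra.
move=> h; split; last nra.
set e := 1 - s in s1 h *; have e1 : e <= 1 by rewrite /e; lra.
have -> : 1 - (1 + s ^+ 2) / 2 = e * (1 - e / 2) by rewrite /e; field.
apply/andP; split; first by rewrite mulr_ge0 //; lra.
(* This expression equals [2 - e * (1 - e / 2) * (v + 3)], the slack in the bound at the next
   index. *)
have : 0 <= (2 - e * (v + 2)) * (1 - e / 2) + e ^+ 2 / 2.
  by rewrite addr_ge0 ?divr_ge0 ?sqr_ge0 // mulr_ge0 //; lra.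
nra.
Qed.

Lemma vanishing_sqrt_scalar : vanishing (fun n => 1 - sqrt_scalar n).
Proof.
move=> e e0; have e20 : 0 < e / 2 by lra.
have [N _ uN] := near_infty_natSinv_lt (PosNum e20); exists N => n Nn.
apply: le_lt_trans (andP (sqrt_scalar_bounds n).1).2 _.
have h : n.+1%:R^-1 < e / 2 := uN n Nn.
have : n.+2%:R^-1 <= n.+1%:R^-1 :> R by rewrite lef_pV2 ?posrE // ler_nat.
set p := n.+2%:R^-1; set q := n.+1%:R^-1 in h *.
lra.
Qed.

Definition sqrt_iter (K : bop H) (n : nat) : bop H :=
  iter n (fun Y => ((2^-1 : R)%:C)%C *: (K + Y * Y)) 0.

Lemma sqrt_iter0 K x : sqrt_iter K 0 x = 0.
Proof. by []. Qed.

Lemma sqrt_iterS K n x : sqrt_iter K n.+1 x =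
  ((2^-1 : R)%:C)%C *: (K x + sqrt_iter K n (sqrt_iter K n x)).
Proof. by []. Qed.

Section SqrtIter.
Variable K : bop H.
Hypothesis Ksym : forall x y, rdot (K x) y = rdot x (K y).
Hypothesis Kle : forall x, nrm (K x) <= nrm x.

Let Y := sqrt_iter K.
Let s := sqrt_scalar.

Let sS n : s n.+1 = (1 + s n ^+ 2) / 2. Proof. by []. Qed.

Lemma sqrt_iter_sym n x y : rdot (Y n x) y = rdot x (Y n y).
Proof.
rewrite /Y; elim: n x y => [|n IH] x y; first by rewrite !sqrt_iter0 rdot0l rdotC rdot0l.
by rewrite !sqrt_iterS rdotZl rdotZr rdotDl rdotDr Ksym !IH.
Qed.

Lemma sqrt_iter_le n x : nrm (Y n x) <= s n * nrm x.
Proof.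
rewrite /Y; elim: n x => [|n IH] x; first by rewrite sqrt_iter0 mul0r nrm0.
rewrite sqrt_iterS nrmZr sS ger0_norm ?invr_ge0 //.
have [_ sn0] := sqrt_scalar_bounds n; rewrite -/(s n) in sn0.
have := nrmD (K x) (sqrt_iter K n (sqrt_iter K n x)); have := Kle x.
have := le_trans (IH _) (ler_wpM2l sn0 (IH x)); lra.
Qed.

Lemma sqrt_scalar_le n : s n <= s n.+1.
Proof.
rewrite sS -subr_ge0 (_ : _ - _ = (1 - s n) ^+ 2 / 2); last by field.
by rewrite divr_ge0 ?sqr_ge0.
Qed.

Lemma sqrt_iter_step n x : nrm (Y n.+1 x - Y n x) <= (s n.+1 - s n) * nrm x.
Proof.
rewrite /Y; elim: n x => [|n IH] x.
  rewrite sqrt_iterS !sqrt_iter0 subr0 addr0 nrmZr sS ger0_norm ?invr_ge0 //.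
  rewrite /s /sqrt_scalar /= expr0n /= addr0 subr0 mul1r ler_wpM2l ?invr_ge0 //.
rewrite [X in nrm (X - _)]sqrt_iterS [X in nrm (_ - X)]sqrt_iterS -scalerBr nrmZr.
rewrite ger0_norm ?invr_ge0 //.
set Y1 := sqrt_iter K n.+1 in IH *; set Y0 := sqrt_iter K n in IH *.
(* The difference of squares is split as [Y1 (Y1 - Y0) + (Y1 - Y0) Y0], so each factor is controlled
   by its scalar counterpart. *)
have -> : K x + Y1 (Y1 x) - (K x + Y0 (Y0 x)) =
    Y1 (Y1 x - Y0 x) + (Y1 (Y0 x) - Y0 (Y0 x)).
  by rewrite linearB /= addrA subrK opprD addrACA subrr add0r.
have [_ s0] := sqrt_scalar_bounds n; have [_ s1] := sqrt_scalar_bounds n.+1.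
rewrite -/(s _) in s0; rewrite -/(s _) in s1.
apply: le_trans (ler_wpM2l _ (nrmD _ _)) _; first by rewrite invr_ge0.
have h1 := le_trans (sqrt_iter_le _ _) (ler_wpM2l s1 (IH x)).
have sl : 0 <= s n.+1 - s n by rewrite subr_ge0 sqrt_scalar_le.
have h2 := le_trans (IH (Y0 x)) (ler_wpM2l sl (sqrt_iter_le n x)).
(* The scalar increments obey the same splitting with equality, which closes the induction. *)
rewrite (_ : s n.+2 - s n.+1 = 2^-1 * (s n.+1 * (s n.+1 - s n) + (s n.+1 - s n) * s n)).
  by move: (s n.+1) (s n) h1 h2 => a b; rewrite /Y -/Y1; lra.
by rewrite (sS n.+1) [X in _ - X]sS; field.
Qed.

(** The dominating scalar increments telescope, and the scalar iterates stay below 1. *)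
Lemma sqrt_iter_cauchy n k x : nrm (Y (n + k)%N x - Y n x) <= (1 - s n) * nrm x.
Proof.
suff h : nrm (Y (n + k)%N x - Y n x) <= (s (n + k)%N - s n) * nrm x.
  apply: le_trans h _; rewrite ler_wpM2r ?nrm_ge0 // lerD2r -subr_ge0.
  by have [/andP[]] := sqrt_scalar_bounds (n + k).
elim: k => [|k IH]; first by rewrite addn0 !subrr nrm0 mul0r.
rewrite addnS -(subrK (Y (n + k)%N x) (Y _.+1 x)) -addrA.
apply: le_trans (nrmD _ _) _.
by have := sqrt_iter_step (n + k) x; move: IH; lra.
Qed.

(** The fixed-point equation [2 Z = K + Z^2] says that [(1 - Z)^2 = 1 - K]; the bound on [Z] will
    make [1 - Z] positive. *)
Lemma sqrt_contraction : exists Z : bop H,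
  [/\ forall x y, rdot (Z x) y = rdot x (Z y), forall x, nrm (Z x) <= nrm x
    & forall x, Z x + Z x = K x + Z (Z x)].
Proof.
pose r n := 1 - s n.
have r0 n : 0 <= r n by have [/andP[]] := sqrt_scalar_bounds n.
have s0 n : 0 <= s n by have [] := sqrt_scalar_bounds n.
have rv : vanishing r := vanishing_sqrt_scalar.
have /choice[f fY] x : exists l, forall n, nrm (Y n x - l) <= r n * nrm x.
  apply: nrm_complete_rate => //; first exact: nrm_ge0.
  by move=> n k; exact: sqrt_iter_cauchy.
have zero (w : H) C : (forall n, nrm w <= r n * C) -> w = 0.
  move=> h; apply: nrm0_eq0; apply/eqP; rewrite eq_le nrm_ge0 andbT.
  exact: vanishing_le h.
have fle x : nrm (f x) <= nrm x.
  by have := fY x 0; rewrite /Y sqrt_iter0 sub0r nrmN /r subr0 mul1r.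
have lf : linear f.
  move=> a x y; apply/eqP; rewrite -subr_eq0; apply/eqP.
  apply: (zero _ (nrm (a *: x + y) + (complex.Re `|a| * nrm x + nrm y))) => n.
  have -> : f (a *: x + y) - (a *: f x + f y) =
    (- (Y n (a *: x + y) - f (a *: x + y))) + (a *: (Y n x - f x) + (Y n y - f y)).
    apply: rdot_ext => z; rewrite (linearP (Y n)) scalerBr !rdotE; ring.
  apply: le_trans (nrmD _ _) _; rewrite nrmN mulrDr; apply: lerD => //.
  apply: le_trans (nrmD _ _) _; rewrite mulrDr; apply: lerD => //.
  by rewrite nrmZ mulrCA ler_wpM2l ?Re_normc_ge0.
have [Z ZE] : exists Z : bop H, forall x, Z x = f x.
  by apply: (@bop_of _ 1) => // x; rewrite mul1r.
exists Z; split=> [x y|x|x]; rewrite ?ZE //.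
  apply/eqP; rewrite -subr_eq0 -normr_eq0 eq_le normr_ge0 andbT.
  apply: (@vanishing_le r _ (nrm x * nrm y + nrm x * nrm y)) => // n.
  have -> : rdot (f x) y - rdot x (f y) = rdot x (Y n y - f y) - rdot (Y n x - f x) y.
    by rewrite !rdotE sqrt_iter_sym; ring.
  apply: le_trans (ler_normB _ _) _; rewrite mulrDr; apply: lerD.
    apply: le_trans (rdot_cauchy _ _) _.
    by rewrite mulrCA ler_wpM2l ?nrm_ge0.
  apply: le_trans (rdot_cauchy _ _) _.
  by rewrite mulrA ler_wpM2r ?nrm_ge0.
apply/eqP; rewrite -subr_eq0; apply/eqP.
apply: (zero _ (4 * nrm x)) => n.
(* The recursion for [2 Y_{n+1}] turns the defect into approximation errors: twice that at stage
   [n.+1] and two at stage [n], together at most [4 * r n * nrm x]. *)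
have -> : f x + f x - (K x + f (f x)) =
  - ((2%:C)%C *: (Y n.+1 x - f x)) + (Y n (Y n x - f x) + (Y n (f x) - f (f x))).
  apply: rdot_ext => z; rewrite (linearB (Y n)) /Y sqrt_iterS !rdotE; lra.
apply: le_trans (nrmD _ _) _; rewrite nrmN nrmZr ger0_norm //.
have h1 := fY x n.+1; have h2 := nrmD (Y n (Y n x - f x)) (Y n (f x) - f (f x)).
have h3 := sqrt_iter_le n (Y n x - f x).
have h4 : s n * nrm (Y n x - f x) <= nrm (Y n x - f x).
  by rewrite ler_piMl ?nrm_ge0 // -subr_ge0 r0.
have h5 := fY x n; have h6 := fY (f x) n.
have h7 : r n * nrm (f x) <= r n * nrm x by rewrite ler_wpM2l.
have h8 : r n.+1 * nrm x <= r n * nrm x.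
  by rewrite ler_wpM2r ?nrm_ge0 // /r lerD2l lerN2 sqrt_scalar_le.
lra.
Qed.
End SqrtIter.

(** * Existence of the absolute value *)

Lemma sqrt_adjoint_mul_exists T :
  exists P : bop H, positive_op P /\ P * P = adjoint T * T.
Proof.
have [M M0 TM] := bop_nrm_bounded T.
(* Dividing by [M^2] brings [S] between 0 and 1, so [K] is a positive contraction; the root of [S]
   is then [M (1 - Z)] with [(1 - Z)^2 = 1 - K]. *)
pose S := adjoint T * T; pose K : bop H := 1 - (((M^-1) ^+ 2)%:C)%C *: S.
have KE x : K x = x - (((M^-1) ^+ 2)%:C)%C *: S x by [].
have Sr x y : rdot (S x) y = rdot (T x) (T y) by rewrite rdotC (rdotC (T x)) rdot_adjoint.
have Sl x y : rdot x (S y) = rdot (T x) (T y) by rewrite rdotC Sr rdotC.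
have Ksym x y : rdot (K x) y = rdot x (K y) by rewrite !KE !rdotE Sr Sl.
have Kxx x : rdot (K x) x = nrm x ^+ 2 - (M^-1 * nrm (T x)) ^+ 2.
  by rewrite KE !rdotE Sr !rdotxx exprMn.
have Kpos x : 0 <= rdot (K x) x.
  rewrite Kxx subr_ge0 ler_pXn2r ?nnegrE ?mulr_ge0 ?nrm_ge0 ?invr_ge0 ?(ltW M0) //.
  by rewrite ler_pdivrMl //.
have Kxx_le x : rdot (K x) x <= 1 * nrm x ^+ 2.
  by rewrite Kxx mul1r gerBl sqr_ge0.
have Kle x : nrm (K x) <= nrm x.
  rewrite -(@ler_pXn2r _ 2) ?nnegrE ?nrm_ge0 //.
  apply: le_trans (positive_nrm_le ltr01 Ksym Kpos Kxx_le x) _.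
  by rewrite !mul1r; have := Kxx_le x; rewrite mul1r.
have [Z [Zsym Zle ZE]] := sqrt_contraction Ksym Kle.
have ZE' x z : rdot (Z (Z x)) z = 2 * rdot (Z x) z - rdot (K x) z.
  by have := congr1 (rdot^~ z) (ZE x); rewrite /= !rdotDl; lra.
pose P : bop H := (M%:C)%C *: (1 - Z).
have PE x : P x = (M%:C)%C *: (x - Z x) by [].
exists P; split.
  apply/positive_opP; split=> [x y|x]; rewrite !PE !rdotE; first by rewrite Zsym.
  rewrite mulr_ge0 ?(ltW M0) // rdotxx subr_ge0 expr2.
  apply: le_trans (ler_norm _) _; apply: le_trans (rdot_cauchy _ _) _.
  by rewrite ler_wpM2r ?nrm_ge0.
apply: val_inj; apply/funext => x; apply: rdot_ext => z.
change (rdot (P (P x)) z = rdot (S x) z).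
rewrite !PE [Z (_ *: _)]linearZ /= [Z (_ - _)]linearB !rdotE ZE' KE !rdotE.
by field; rewrite gt_eqF.
Qed.

Lemma abs_opP T : positive_op (abs_op T) /\ abs_op T * abs_op T = adjoint T * T.
Proof.
rewrite /abs_op /sqrt_op; case: xgetP => [P _ //|noP].
by have [P /noP] := sqrt_adjoint_mul_exists T.
Qed.

Lemma nrm_abs_op T x : nrm (abs_op T x) = nrm (T x).
Proof.
have [/positive_opP[Psym _] PP] := abs_opP T.
apply/eqP; rewrite -(@eqrXn2 _ 2) ?nrm_ge0 // -!rdotxx Psym; apply/eqP.
change (rdot x ((abs_op T * abs_op T) x) = rdot (T x) (T x)).
by rewrite PP rdot_adjoint.
Qed.

(** * Invertibility through lower bounds *)

Lemma invertible_bounded_below T : invertible T ->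
  exists2 c, 0 < c & forall x, c * nrm x <= nrm (T x).
Proof.
move=> [S [ST _]]; have [M M0 SM] := bop_nrm_bounded S.
exists M^-1 => [|x]; first by rewrite invr_gt0.
rewrite ler_pdivrMl //.
have {1}<- : S (T x) = x by rewrite -[RHS]/((1 : bop H) x) -ST.
exact: SM.
Qed.

(** The lower bound makes [T] injective, so a chosen right inverse is linear and two-sided, and it
    bounds that inverse by [c^-1]. *)
Lemma bounded_below_surj_invertible T c : 0 < c ->
  (forall x, c * nrm x <= nrm (T x)) -> (forall y, exists x, T x = y) -> invertible T.
Proof.
move=> c0 Tc /choice[f fT].
have Tinj x y : T x = T y -> x = y.
  move=> Txy; apply/subr0_eq/nrm0_eq0/eqP; rewrite eq_le nrm_ge0 andbT.
  by have := Tc (x - y); rewrite linearB /= Txy subrr nrm0 pmulr_rle0.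
have lf : linear f by move=> a x y; apply: Tinj; rewrite linearP /= !fT.
have [S SE] : exists S : bop H, forall x, S x = f x.
  apply: (@bop_of _ c^-1) => // x.
  by rewrite ler_pdivlMl // -{2}(fT x).
exists S; split; apply: val_inj; apply/funext => x /=; last by rewrite SE fT.
by apply: Tinj; rewrite SE fT.
Qed.

Lemma coercive_surj T c : 0 < c ->
  (forall x y, rdot (T x) y = rdot x (T y)) ->
  (forall x, c * nrm x ^+ 2 <= rdot (T x) x) -> forall y, exists x, T x = y.
Proof.
move=> c0 Tsym Tc y.
have [x xE] : exists x, forall z, rdot (T x) z = rdot y z.
  apply: (coercive_represents (F := nrm y) c0 Tsym Tc) => [x z|t x|x].
  - exact: rdotDr.
  - exact: rdotZr.
  - exact: le_trans (ler_norm _) (rdot_cauchy _ _).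
by exists x; apply: rdot_ext.
Qed.

Lemma coercive_bounded_below T c : 
  (forall x, c * nrm x ^+ 2 <= rdot (T x) x) -> forall x, c * nrm x <= nrm (T x).
Proof.
move=> Tc x; have [->|x0] := eqVneq x 0; first by rewrite linear0 nrm0 mulr0.
have nx : 0 < nrm x.
  by rewrite lt_neqAle nrm_ge0 andbT eq_sym; apply: contraNneq x0 => /nrm0_eq0 ->.
rewrite -(ler_pM2r nx) -mulrA -expr2.
by apply: le_trans (Tc x) (le_trans (ler_norm _) (rdot_cauchy _ _)).
Qed.

(** The operator [adjoint T * T] is coercive with constant [c ^+ 2], hence surjective; by normality
    its range is that of [T * adjoint T], which lies in the range of [T]. *)
Lemma normal_bounded_below_invertible T c : normal_op T -> 0 < c ->
  (forall x, c * nrm x <= nrm (T x)) -> invertible T.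
Proof.
move=> Tn c0 Tc; apply: (bounded_below_surj_invertible c0 Tc) => y.
have Sr x z : rdot ((adjoint T * T) x) z = rdot (T x) (T z).
  by rewrite rdotC (rdotC (T x)) rdot_adjoint.
have [|x z|x|x <-] := @coercive_surj (adjoint T * T) (c ^+ 2) _ _ _ y.
- exact: exprn_gt0.
- by rewrite Sr [RHS]rdotC Sr rdotC.
- rewrite Sr rdotxx -exprMn ler_pXn2r ?nnegrE ?nrm_ge0 //.
  by rewrite mulr_ge0 ?nrm_ge0 // ltW.
- by exists (adjoint T x); rewrite -[LHS]/((T * adjoint T) x) Tn.
Qed.

(** * The equivalence for a normal operator *)

(** Normality gives [T x] and [adjoint T x] the same norm; the parallelogram law for these two
    vectors does the rest. *)
Lemma nrm_sqr_re_im T x : normal_op T ->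
  nrm (T x) ^+ 2 = nrm (re_op T x) ^+ 2 + nrm (im_op T x) ^+ 2.
Proof.
move=> Tn.
have -> : re_op T x = 2^-1 *: (T x + adjoint T x) by [].
have -> : im_op T x = (2 * 'i)^-1 *: (T x - adjoint T x) by [].
have n2 : complex.Re `|2^-1 : R[i]| = 2^-1.
  by rewrite normfV normr_nat -(rmorph_nat (real_complex R)) -fmorphV.
have n2i : complex.Re `|(2 * 'i)^-1 : R[i]| = 2^-1.
  by rewrite -n2 !normfV normrM normCi mulr1.
rewrite !nrmZ n2 n2i !exprMn -!rdotxx !rdotE.
have : rdot (adjoint T x) (adjoint T x) = rdot (T x) (T x).
  by rewrite -rdot_adjoint [RHS]rdot_adjoint -[T (_ _)]/((T * adjoint T) x) Tn rdotC.
rewrite (rdotC (adjoint T x) (T x)); move: (rdot _ _) => p; lra.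
Qed.

Lemma invertible_abs_re_im T : normal_op T ->
  invertible T <-> invertible (abs_op (re_op T) + abs_op (im_op T)).
Proof.
move=> Tn; set P := abs_op _; set Q := abs_op _.
have [/positive_opP[Psym Ppos] _] := abs_opP (re_op T).
have [/positive_opP[Qsym Qpos] _] := abs_opP (im_op T).
rewrite -/P -/Q in Psym Ppos Qsym Qpos.
have Tn2 x : nrm (T x) ^+ 2 = nrm (P x) ^+ 2 + nrm (Q x) ^+ 2.
  by rewrite !nrm_abs_op nrm_sqr_re_im.
have PQE x : (P + Q) x = P x + Q x by [].
split=> /invertible_bounded_below[c c0 bc].
  have bound (S : bop H) : exists2 M, 0 < M & forall x, rdot (S x) x <= M * nrm x ^+ 2.
    have [M M0 SM] := bop_nrm_bounded S; exists M => // x.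
    apply: le_trans (ler_norm _) _; apply: le_trans (rdot_cauchy _ _) _.
    by rewrite expr2 mulrA ler_wpM2r ?nrm_ge0.
  have [M M0 PM] := bound P; have [N N0 QN] := bound Q.
  have PQsym x y : rdot ((P + Q) x) y = rdot x ((P + Q) y).
    by rewrite !PQE !rdotE Psym Qsym.
  have MN0 : 0 < M + N by rewrite addr_gt0.
  (* The squared norm of [T x] is at most [M <P x, x> + N <Q x, x>], and the missing mixed terms
     [N <P x, x>] and [M <Q x, x>] are nonnegative. *)
  have PQc x : c ^+ 2 / (M + N) * nrm x ^+ 2 <= rdot ((P + Q) x) x.
    rewrite mulrAC ler_pdivrMr // -exprMn PQE rdotDl.
    have : (c * nrm x) ^+ 2 <= nrm (T x) ^+ 2.
      by rewrite ler_pXn2r ?nnegrE ?mulr_ge0 ?nrm_ge0 ?(ltW c0).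
    move/le_trans; apply; rewrite Tn2.
    have := positive_nrm_le M0 Psym Ppos PM x.
    have := positive_nrm_le N0 Qsym Qpos QN x.
    have := mulr_ge0 (ltW M0) (Qpos x); have := mulr_ge0 (ltW N0) (Ppos x); lra.
  have cMN0 : 0 < c ^+ 2 / (M + N) by rewrite divr_gt0 ?exprn_gt0.
  apply: (bounded_below_surj_invertible cMN0).
    exact: coercive_bounded_below.
  exact: coercive_surj PQc.
(* From [(p + q)^2 <= 2 (p^2 + q^2)] the constant [c / sqrt 2] would do; [c / 2] is smaller and
   rational in [c]. *)
have c20 : 0 < c / 2 by rewrite divr_gt0.
apply: (normal_bounded_below_invertible Tn c20) => x.
rewrite -(@ler_pXn2r _ 2) ?nnegrE ?mulr_ge0 ?nrm_ge0 ?(ltW c20) ?(ltW c0) // Tn2.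
have := le_trans (bc x) (nrmD (P x) (Q x)).
rewrite -(@ler_pXn2r _ 2) ?nnegrE ?addr_ge0 ?mulr_ge0 ?nrm_ge0 ?(ltW c0) //.
have := sqr_ge0 (nrm (P x) - nrm (Q x)).
have := sqr_ge0 (nrm (P x)); have := sqr_ge0 (nrm (Q x)); lra.
Qed.

(** * Translation by a scalar, for the spectral statement *)

Lemma adjoint_shift T (l : R[i]) :
  adjoint (T - l *: (1 : bop H)) = adjoint T - (conjc l)%C *: (1 : bop H).
Proof.
apply: adjoint_unique => x y.
change ('[T x - l *: x, y] = '[x, adjoint T y - (conjc l)%C *: y]).
rewrite linearBl linearBr /= adjointE linearZl_LR (hermC _ x (_ *: y)) /=.
by rewrite linearZl_LR /= rmorphM /= conjCE conjcK (hermC _ x y) expr0 !mul1r.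
Qed.

Lemma normal_shift T l : normal_op T -> normal_op (T - l *: (1 : bop H)).
Proof.
move=> Tn; rewrite /normal_op adjoint_shift.
apply: val_inj; apply/funext => x.
change (T (adjoint T x - (conjc l)%C *: x) - l *: (adjoint T x - (conjc l)%C *: x) =
  adjoint T (T x - l *: x) - (conjc l)%C *: (T x - l *: x)).
have h : T (adjoint T x) = adjoint T (T x) by rewrite -[LHS]/((T * adjoint T) x) Tn.
apply: rdot_ext => z.
rewrite !linearB !linearZ /= h ?scalerBr !scalerA (mulrC l) !rdotE; ring.
Qed.

Lemma re_op_shift T (a b : R) :
  re_op (T - (a +i* b)%C *: (1 : bop H)) = re_op T - (a%:C)%C *: (1 : bop H).
Proof.
rewrite /re_op adjoint_shift addrACA -opprD -scalerDl scalerBr scalerA.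
congr (_ - _ *: _); rewrite addcJ /= mulrA mulVf ?mul1r // pnatr_eq0 //.
Qed.

Lemma imaginaryE : 'i = 'i%C :> R[i].
Proof. by []. Qed.

Lemma im_op_shift T (a b : R) :
  im_op (T - (a +i* b)%C *: (1 : bop H)) = im_op T - (b%:C)%C *: (1 : bop H).
Proof.
rewrite /im_op adjoint_shift.
set l := (a +i* b)%C.
have -> : T - l *: (1 : bop H) - (adjoint T - (conjc l)%C *: (1 : bop H)) =
    T - adjoint T - (l - (conjc l)%C) *: (1 : bop H).
  by rewrite scalerBl opprD opprK addrACA opprB [- _ + _]addrC.
(* The difference [l - conjc l] is [2 i b], which the factor [(2 * 'i)^-1] reduces to [b]. *)
rewrite scalerBr scalerA subcJ.
by rewrite /= -imaginaryE (mulrAC 2) mulKf // mulf_neq0 ?neq0Ci ?pnatr_eq0.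
Qed.

End RealStructure.

Theorem proposition2p12 (R : realType) (H : hilbertType R) (T : bop H) :
  normal_op T ->
  let A := re_op T in
  let B := im_op T in
  (invertible T <-> invertible (abs_op A + abs_op B)) /\
  (forall a b : R,
     spectrum T (a +i* b)%C <->
     ~ invertible (abs_op (A - (a%:C)%C *: (1 : bop H)) + abs_op (B - (b%:C)%C *: (1 : bop H)))).
Proof.
move=> Tn A B; split=> [|a b]; first exact: invertible_abs_re_im.
have := invertible_abs_re_im (normal_shift (a +i* b)%C Tn).
by rewrite re_op_shift im_op_shift => h; split=> nT /h.
Qed.
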